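(* Let $C>0$ be a constant. Let $G$ be a connected $(n,d,\lambda)$ graph (with $n \to \infty$) such that $\lambda \le C\sqrt{d}$ and $d \ge 2C\sqrt{n \ln^{1/9} n}$. Then for any vertex $v$ of $G$, with probability $1-o(1)$, $$|T(G,v) - (\log_2 n + \ln n)| = o(\ln n).$$
   Context: An $(n,d,\lambda)$ graph is a $d$-regular graph on $n$ vertices whose adjacency matrix has eigenvalues $\lambda_1 = d \ge \lambda_2 \ge \dots \ge \lambda_n$ (real, as the matrix is symmetric), with $\lambda := \max_{2 \le i \le n}|\lambda_i|$. Push model: initially only the vertex $v$ is informed; in each round every informed vertex independently chooses a neighbor uniformly at random and transmits the information to it. $T(G,v)$ is the number of rounds until all vertices are informed. The hypotheses hold for all sufficiently large $n$; asymptotic notation refers to $n \to \infty$, and the probability is over the random choices of the protocol. *)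

(* Defs.v *)
From HB Require Import structures.
From mathcomp Require Import all_boot all_order all_algebra.
From mathcomp Require Import all_classical all_reals all_analysis.
Set Implicit Arguments. Unset Strict Implicit. Unset Printing Implicit Defensive.
Import Order.TTheory GRing.Theory Num.Theory.
Local Open Scope ring_scope.

Section Graphs.
Variable n : nat.

Definition simple_graph (e : rel 'I_n) : Prop :=
  (forall u w, e u w = e w u) /\ (forall u, ~~ e u u).

Definition regular (e : rel 'I_n) (d : nat) : Prop :=
  forall u, #|[set w | e u w]| = d.

Definition connected_graph (e : rel 'I_n) : Prop :=
  forall u w, connect e u w.

Definition adjmx (R : nzRingType) (e : rel 'I_n) : 'M[R]_n :=
  \matrix_(i, j) (e i j)%:R.

Definition second_eig_abs (R : realType) (A : 'M[R]_n) (lam : R) : Prop :=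
  exists s : 'I_n -> R,
    [/\ char_poly A = \prod_(i < n) ('X - (s i)%:P),
        (forall i j : 'I_n, (i <= j)%N -> s j <= s i) &
        lam = \big[Num.max/0]_(i < n | (0 < i)%N) `|s i| ].

Variable R : realType.
Variable e : rel 'I_n.

(* a choice function for informed set S: every informed vertex u chooses a
   neighbour f u; uninformed vertices are fixed (f u = u) to make the
   choice tuple canonical *)
Definition valid_choice (S : {set 'I_n}) (f : {ffun 'I_n -> 'I_n}) : bool :=
  [forall u, if u \in S then e u (f u) else f u == u].

Definition push_step (S : {set 'I_n}) (f : {ffun 'I_n -> 'I_n}) : {set 'I_n} :=
  S :|: [set f u | u in S].

(* one-round transition probability: choices are independent and uniform,
   i.e. the choice tuple is uniform over all valid tuples *)
Definition push_kernel (S S' : {set 'I_n}) : R :=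
  #|[set f | valid_choice S f & push_step S f == S']|%:R /
  #|[set f | valid_choice S f]|%:R.

Fixpoint push_dist (v : 'I_n) (t : nat) : {set 'I_n} -> R :=
  match t with
  | 0 => fun S => (S == [set v])%:R
  | t'.+1 => fun S' => \sum_(S : {set 'I_n}) push_dist v t' S * push_kernel S S'
  end.

(* P(T(G,v) <= t): the full set is absorbing *)
Definition probT_le (v : 'I_n) (t : nat) : R := push_dist v t [set: 'I_n].

Definition probT_eq (v : 'I_n) (t : nat) : R :=
  if t is t'.+1 then probT_le v t - probT_le v t' else probT_le v 0.

(* P(|T(G,v) - L| <= r); every t with |t - L| <= r satisfies t < truncn (L + r) + 1 *)
Definition probT_within (v : 'I_n) (L r : R) : R :=
  \sum_(t < (Num.truncn (L + r)).+1 | `|t%:R - L| <= r) probT_eq v t.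

End Graphs.

(* Main.v *)
Require Import Defs.
From HB Require Import structures.
From mathcomp Require Import all_boot all_order all_algebra complex.
From mathcomp Require Import all_classical all_reals all_analysis.
From mathcomp Require Import ring lra fintype finset.
Set Implicit Arguments. Unset Strict Implicit. Unset Printing Implicit Defensive.
Import Order.TTheory GRing.Theory Num.Theory.
Local Open Scope ring_scope.

(** Write [S] for the informed set, [s] for its size, [U] for its complement and
    [y w] for the fraction of the neighbours of [w] lying in [S].  The spectral gap
    gives [\sum_w (y w - s / n) ^ 2 <= C ^ 2 * s / d], and in one round [w] stays
    uninformed with probability [(1 - 1 / d) ^ (d * y w)].  Every phase is then a
    potential contracted in expectation by each round:
    - while [s] is a small fraction of [n], [1 / s] shrinks by a factor close to
      [1 / 2], hence about [log2 n] rounds to inform a constant fraction;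
    - afterwards [|U|] shrinks by a constant factor, which tends to [1 / e] as [U]
      gets small, hence about [ln n] further rounds;
    - conversely [s] at most doubles, and [1 / (k + |U|)] grows by a factor at most
      about [e], because [|U|] has variance at most its mean after one round.
    Markov's inequality for these potentials gives both tails. *)

(** * Second eigenvalue of a symmetric matrix *)

Lemma char_poly_conj (F : fieldType) (n : nat) (P B : 'M[F]_n) :
  P \in unitmx -> char_poly (invmx P *m B *m P) = char_poly B.
Proof.
move=> Pu; rewrite /char_poly.
have -> : char_poly_mx (invmx P *m B *m P) =
    map_mx polyC (invmx P) *m char_poly_mx B *m map_mx polyC P.
  rewrite /char_poly_mx mulmxBr mulmxBl -!map_mxM; congr (_ - _).
  by rewrite scalar_mxC -mulmxA -map_mxM mulVmx // map_mx1 mulmx1.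
rewrite !det_mulmx mulrAC -det_mulmx -map_mxM mulVmx //.
by rewrite map_mx1 det1 mul1r.
Qed.

Section NormalMatrix.
Local Open Scope sesquilinear_scope.
Variables (F : numClosedFieldType) (n : nat).

Lemma unitarymx_sqnorm (P : 'M[F]_n) (y : 'rV[F]_n) : P \is unitarymx ->
  \sum_j `|(y *m P) 0 j| ^+ 2 = \sum_j `|y 0 j| ^+ 2.
Proof.
move=> PU.
have E (z : 'rV[F]_n) : \sum_j `|z 0 j| ^+ 2 = (z *m z^t*) 0 0.
  by rewrite mxE; apply: eq_bigr => j _; rewrite !mxE normCK.
rewrite !E trmx_mul map_mxM mulmxA -[y *m P *m _]mulmxA.
by rewrite (unitarymxP PU) mulmx1.
Qed.

(** In a unitary eigenbasis of [A] only one diagonal entry can exceed [lam] in modulus, and [u] is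
    supported on that coordinate. Orthogonality to [u] kills this coordinate of [x]; every other one
    is scaled by at most [lam]. *)
Lemma normalmx_second_eig (A : 'M[F]_n) (s : 'I_n -> F) (i0 : 'I_n)
    (mu lam : F) (u x : 'rV[F]_n) :
  A \is normalmx -> char_poly A = \prod_(i < n) ('X - (s i)%:P) ->
  (forall i, i != i0 -> `|s i| <= lam) -> lam < `|mu| ->
  u != 0 -> u *m A = mu *: u -> (x *m u^t*) 0 0 = 0 ->
  \sum_j `|(x *m A) 0 j| ^+ 2 <= lam ^+ 2 * \sum_j `|x 0 j| ^+ 2.
Proof.
move=> /orthomx_spectralP; set P := spectralmx A; set D := spectral_diag A.
have PU : P \is unitarymx by exact: spectral_unitarymx.
have Pu : P \in unitmx by exact: unitarymx_unit.
move=> AE chA slam lammu u0 uA xu.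
(* Both lists are the roots of the characteristic polynomial with multiplicity. *)
have pe : perm_eq [seq s i | i <- enum 'I_n] [seq D 0 i | i <- enum 'I_n].
  apply: prod_XsubC_eq; rewrite !big_image /= -chA AE char_poly_conj //=.
  rewrite (char_poly_trig (diag_mx_is_trig _)).
  by apply: eq_bigr => i _; rewrite mxE eqxx mulr1n.
pose big (z : F) := ~~ (`|z| <= lam).
have cnt : (count big [seq D 0%R i | i <- enum 'I_n] <= 1)%N.
  rewrite -(permP pe) count_map -size_filter.
  apply: (@uniq_leq_size _ _ [:: i0]) => [|i].
    by rewrite filter_uniq // enum_uniq.
  rewrite mem_filter /= inE => /andP[bi _]; apply: contraR bi => ii0.
  exact: slam.
have cnt1 i j : big (D 0 i) -> big (D 0 j) -> i = j.
  move=> bi bj; apply/eqP; apply: contraLR cnt => ij; rewrite -ltnNge.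
  rewrite count_map -size_filter.
  apply: (@uniq_leq_size _ [:: i; j]); first by rewrite /= inE ij.
  move=> k; rewrite !inE mem_filter mem_enum andbT /=.
  by case/orP => /eqP ->.
have PA : P *m A = diag_mx D *m P.
  by rewrite {1}AE !mulmxA mulmxV // mul1mx.
have [c uE] : exists c, u = c *m P by exists (u *m invmx P); rewrite mulmxKV.
have [y xE] : exists y, x = y *m P by exists (x *m invmx P); rewrite mulmxKV.
have AC (z : 'rV[F]_n) i : (z *m diag_mx D) 0 i = z 0 i * D 0 i.
  by rewrite mul_mx_diag mxE.
have cD i : c 0 i * D 0 i = mu * c 0 i.
  rewrite -AC; have : c *m diag_mx D = mu *: c.
    apply: (can_inj (mulmxK Pu)); rewrite -scalemxAl -uE -mulmxA -PA mulmxA.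
    by rewrite -uE.
  by move=> ->; rewrite mxE.
have [i1 ci1] : exists i1, c 0 i1 != 0.
  apply/existsP; apply: contraR u0; rewrite negb_exists => /forallP c0.
  rewrite uE; have -> : c = 0; last by rewrite mul0mx.
  by apply/rowP => i; rewrite [RHS]mxE; apply/eqP; have := c0 i; rewrite negbK.
have Dbig i : c 0 i != 0 -> big (D 0 i).
  move=> ci; have -> : D 0 i = mu by apply: (mulfI ci); rewrite cD mulrC.
  by rewrite /big; apply/negP => /(lt_le_trans lammu); rewrite ltxx.
have c0 i : i != i1 -> c 0 i = 0.
  by move=> ii1; apply: contra_neq_eq ii1 => /Dbig bi; apply: cnt1 => //; exact: Dbig.
have y1 : y 0 i1 = 0.
  move: xu; rewrite uE xE trmx_mul map_mxM mulmxA -[y *m P *m _]mulmxA.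
  rewrite (unitarymxP PU) mulmx1 mxE (bigD1 i1) //= big1 => [|i ii1].
    by rewrite addr0 !mxE => /eqP; rewrite mulf_eq0 conjC_eq0 (negbTE ci1) orbF => /eqP.
  by rewrite !mxE c0 // conjC0 mulr0.
have -> : x *m A = (y *m diag_mx D) *m P by rewrite -mulmxA -PA mulmxA -xE.
rewrite xE !(unitarymx_sqnorm _ PU) mulr_sumr; apply: ler_sum => i _.
rewrite AC normrM exprMn mulrC.
have [->|ii1] := eqVneq i i1; first by rewrite y1 normr0 expr0n !mulr0.
apply: ler_wpM2r; first exact: exprn_ge0.
have Dle : `|D 0 i| <= lam.
  by apply: contraNT ii1 => bi; apply/eqP; apply: cnt1 => //; exact: Dbig.
by rewrite lerXn2r ?nnegrE // (le_trans _ Dle).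
Qed.
End NormalMatrix.

(** Over [R[i]] the spectral theorem for normal matrices applies; orthogonality to the all-ones
    eigenvector is a vanishing coordinate sum. *)
Lemma symmetric_second_eig (R : rcfType) (n : nat) (A : 'M[R]_n)
    (s : 'I_n -> R) (i0 : 'I_n) (mu lam : R) (x : 'rV[R]_n) :
  A^T = A -> char_poly A = \prod_(i < n) ('X - (s i)%:P) ->
  (forall i, i != i0 -> `|s i| <= lam) -> lam < mu ->
  const_mx 1 *m A = mu *: (const_mx 1 : 'rV[R]_n) -> \sum_j x 0 j = 0 ->
  \sum_j ((x *m A) 0 j) ^+ 2 <= lam ^+ 2 * \sum_j (x 0 j) ^+ 2.
Proof.
move=> AT chA slam lammu oneA x0.
pose f : {rmorphism R -> R[i]} := real_complex R.
have fnorm (r : R) : `|f r| = f `|r| by rewrite normc_def /= expr0n addr0 sqrtr_sqr.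
have fle (a b : R) : (f a <= f b) = (a <= b) by exact: lecR.
have conjf (r : R) : (f r)^* = f r by rewrite conj_Creal // complex_real.
have fs (z : 'rV[R]_n) : f (\sum_j (z 0 j) ^+ 2) = \sum_j `|(map_mx f z) 0 j| ^+ 2.
  rewrite rmorph_sum; apply: eq_bigr => j _.
  by rewrite mxE fnorm -rmorphXn real_normK // num_real.
rewrite -fle rmorphM rmorphXn !fs map_mxM /=.
apply: (@normalmx_second_eig _ _ _ (f \o s) i0 (f mu) (f lam) (const_mx 1)).
- apply: hermitian_normalmx; apply: realsym_hermsym.
    apply/is_hermitianmxP; rewrite expr0 scale1r; apply/matrixP => i j.
    by rewrite !mxE -[in LHS]AT mxE.
  by apply/mxOverP => i j; rewrite mxE complex_real.
- rewrite -map_char_poly chA rmorph_prod; apply: eq_bigr => i _.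
  by rewrite rmorphB /= map_polyX map_polyC.
- by move=> i ii0; rewrite /= fnorm fle slam.
- by rewrite fnorm ltcR (lt_le_trans lammu) ?ler_norm.
- apply/negP => /eqP/rowP/(_ i0); rewrite !mxE => /eqP.
  by rewrite oner_eq0.
- have := congr1 (map_mx f) oneA; rewrite map_mxM map_mxZ.
  by rewrite map_const_mx rmorph1.
- have : f (\sum_j x 0 j) = 0 by rewrite x0 rmorph0.
  move=> <-; rewrite rmorph_sum mxE; apply: eq_bigr => j _.
  by rewrite !mxE conjC1 mulr1.
Qed.

(** * One round of the protocol *)

Section PushOperator.
Variables (R : realType) (n : nat) (e : rel 'I_n).
Implicit Types (S W : {set 'I_n}) (f : {ffun 'I_n -> 'I_n}) (g h : {set 'I_n} -> R).

Definition in_degree S (w : 'I_n) : nat := #|[set u in S | e u w]|.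

(** The adjacency matrix maps the indicator of [S], centred by its mean, to the deviations of the
    in-degrees, and this vector has squared norm [s - s ^ 2 / n]. By [lam < d%:R], the eigenvalue
    [d] of the all-ones vector is the one excluded from the maximum [lam]. *)
Lemma discrepancy_le (d : nat) (lam : R) S :
  simple_graph e -> regular e d -> second_eig_abs (adjmx R e) lam ->
  lam < d%:R ->
  \sum_w ((in_degree S w)%:R - d%:R * (#|S|%:R / n%:R)) ^+ 2 <= lam ^+ 2 * #|S|%:R.
Proof.
move=> [esym _] ereg [s [chA ssort lamE]] lamd.
have [n0|n0] := posnP n.
  rewrite big1 => [|w]; last by have := ltn_ord w; rewrite {2}n0.
  by rewrite mulr_ge0 ?sqr_ge0.
have nR : n%:R != 0 :> R by rewrite pnatr_eq0 -lt0n.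
pose x : 'rV[R]_n := \row_j ((j \in S)%:R - #|S|%:R / n%:R).
have cardS : \sum_j (j \in S)%:R = #|S|%:R :> R.
  rewrite -sum1_card natr_sum [RHS]big_mkcond /=.
  by apply: eq_bigr => j _; case: (j \in S).
have xA w : (x *m adjmx R e) 0 w = (in_degree S w)%:R - d%:R * (#|S|%:R / n%:R).
  rewrite mxE (eq_bigr (fun j => (j \in S)%:R * (e j w)%:R
                         - #|S|%:R / n%:R * (e j w)%:R)); last first.
    by move=> j _; rewrite !mxE mulrBl.
  rewrite sumrB -mulr_sumr [d%:R * _]mulrC; congr (_ - _ * _).
    rewrite /in_degree -sum1_card natr_sum [RHS]big_mkcond /=.
    by apply: eq_bigr => j _; rewrite inE -natrM mulnb; case: ifP.
  rewrite -(ereg w) -sum1_card natr_sum [RHS]big_mkcond /=.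
  by apply: eq_bigr => j _; rewrite inE esym; case: ifP.
have x2 : \sum_j (x 0 j) ^+ 2 <= #|S|%:R.
  have -> : \sum_j (x 0 j) ^+ 2 = #|S|%:R - #|S|%:R ^+ 2 / n%:R.
    rewrite (eq_bigr (fun j => (j \in S)%:R - (2 * (#|S|%:R / n%:R)) * (j \in S)%:R
        + (#|S|%:R / n%:R) ^+ 2)); last first.
      by move=> j _; rewrite mxE; case: (j \in S) => /=; ring.
    rewrite big_split /= sumrB -mulr_sumr cardS sumr_const card_ord.
    rewrite -[_ ^+ 2 *+ n]mulr_natr.
    by field.
  by rewrite gerBl divr_ge0 // ?sqr_ge0.
rewrite -(eq_bigr _ (fun w _ => congr1 (fun z => z ^+ 2) (xA w))).
have lam0 : 0 <= lam by rewrite lamE bigmax_ge_id.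
apply: le_trans (ler_wpM2l (sqr_ge0 lam) x2).
apply: (@symmetric_second_eig _ _ _ s (Ordinal n0) d%:R).
- by apply/matrixP => i j; rewrite !mxE esym.
- by [].
- move=> i i0; rewrite lamE; apply: (le_bigmax_cond 0 (fun i => `|s i|)).
  by rewrite lt0n; apply: contra i0 => /eqP i0; apply/eqP/val_inj.
- by [].
- apply/rowP => j; rewrite !mxE mulr1 -(ereg j) -sum1_card natr_sum [RHS]big_mkcond /=.
  by apply: eq_bigr => i _; rewrite !mxE mul1r inE esym; case: ifP.
- rewrite (eq_bigr (fun j => (j \in S)%:R - #|S|%:R / n%:R)); last first.
    by move=> j _; rewrite mxE.
  by rewrite sumrB cardS sumr_const card_ord -[_ *+ n]mulr_natr divfK ?subrr.
Qed.

(** * Conditional expectation over one round, as an operator on functions of the informed set *)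

Definition push_op g S : R := \sum_(S' : {set 'I_n}) push_kernel R e S S' * g S'.

Lemma push_opE g S :
  push_op g S = (\sum_(f | valid_choice e S f) g (push_step S f))
                 / #|[set f | valid_choice e S f]|%:R.
Proof.
rewrite mulr_suml (partition_big (push_step S) xpredT) //=.
apply: eq_bigr => S' _.
rewrite (eq_bigr (fun _ => g S' / #|[set f | valid_choice e S f]|%:R)); last first.
  by move=> f /andP[_ /eqP ->].
rewrite sumr_const /push_kernel -[RHS]mulr_natl [RHS]mulrA [RHS]mulrAC.
by congr (_ * _ * _); congr (_%:R); apply: eq_card => f; rewrite !inE.
Qed.

Lemma push_opD g h S : push_op (fun S' => g S' + h S') S = push_op g S + push_op h S.
Proof. by rewrite -big_split; apply: eq_bigr => S' _; rewrite mulrDr. Qed.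

Lemma push_opZ a g S : push_op (fun S' => a * g S') S = a * push_op g S.
Proof. by rewrite mulr_sumr; apply: eq_bigr => S' _; rewrite mulrCA. Qed.

Lemma push_op_sum (I : finType) (P : pred I) (G : I -> {set 'I_n} -> R) S :
  push_op (fun S' => \sum_(i | P i) G i S') S = \sum_(i | P i) push_op (G i) S.
Proof.
by rewrite exchange_big; apply: eq_bigr => S' _; rewrite mulr_sumr.
Qed.

(** A round only adds vertices, at most one per informed vertex, so no other [S'] carries weight. *)
Lemma push_op_le g h S :
  (forall S', S \subset S' -> (#|S'| <= 2 * #|S|)%N -> g S' <= h S') ->
  push_op g S <= push_op h S.
Proof.
move=> gh; rewrite !push_opE ler_wpM2r ?invr_ge0 //; apply: ler_sum => f _.
apply: gh; first exact: subsetUl.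
rewrite mul2n -addnn (leq_trans (leq_card_setU _ _)) // leq_add2l.
exact: leq_imset_card.
Qed.

Variable d : nat.
Hypotheses (ereg : regular e d) (d_gt0 : (0 < d)%N).

Let d_neq0 : d%:R != 0 :> R.
Proof. by rewrite pnatr_eq0 -lt0n. Qed.

(** Independence of the choices: valid choice functions form a product set, over which product and
    sum can be exchanged. *)
Lemma sum_valid_choice_prod (F : 'I_n -> 'I_n -> R) S :
  \sum_(f | valid_choice e S f) \prod_(u in S) F u (f u)
  = \prod_(u in S) \sum_(w | e u w) F u w.
Proof.
(* Uninformed vertices get one admissible value and the factor 1, so that the product runs over all
   vertices. *)
pose Q u : pred 'I_n := fun w => if u \in S then e u w else w == u.
pose G u w := if u \in S then F u w else 1.
transitivity (\prod_u \sum_(w | Q u w) G u w); last first.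
  rewrite [RHS]big_mkcond /=; apply: eq_bigr => u _; rewrite /Q /G.
  by case: (u \in S) => //; rewrite big_pred1_eq.
rewrite bigA_distr_big_dep; apply: eq_big => [f|f _].
  apply/forallP/familyP => H u; have := H u; by rewrite /Q unfold_in.
by rewrite [LHS]big_mkcond; apply: eq_bigr.
Qed.

Lemma card_valid_choice S : #|[set f | valid_choice e S f]|%:R = d%:R ^+ #|S| :> R.
Proof.
rewrite cardsE -sum1_card natr_sum.
rewrite (eq_bigr (fun f => \prod_(u in S) 1)) => [|f _]; last by rewrite big1.
rewrite (sum_valid_choice_prod (fun _ _ => 1)).
rewrite (eq_bigr (fun=> d%:R)) ?prodr_const // => u _.
by rewrite sumr_const -(ereg u) cardsE.
Qed.

Lemma push_op_cst (c : R) S : push_op (fun=> c) S = c.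
Proof.
rewrite push_opE sumr_const -[c *+ _]mulr_natr -cardsE.
by rewrite card_valid_choice mulfK // expf_neq0.
Qed.

(** Each [u] in [S] avoids [W] independently, with probability one minus the fraction of its
    neighbours in [W]. *)
Lemma push_op_disjoint S W : [disjoint S & W] ->
  push_op (fun S' => [disjoint S' & W]%:R) S
  = \prod_(u in S) (1 - #|[set w in W | e u w]|%:R / d%:R).
Proof.
move=> dSW; rewrite push_opE card_valid_choice.
rewrite (eq_bigr (fun f => \prod_(u in S) (f u \notin W)%:R)); last first.
  move=> f _; rewrite /push_step disjoints_subset subUset -disjoints_subset dSW /=.
  apply/esym; case: (boolP (_ \subset _)) => [/subsetP sub|].
    rewrite big1 // => u uS; have := sub (f u) (imset_f _ uS).
    by rewrite inE => ->.
  case/subsetPn => _ /imsetP[u uS ->]; rewrite inE negbK => fuW.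
  by rewrite (bigD1 u) //= fuW mul0r.
rewrite (sum_valid_choice_prod (fun u w => (w \notin W)%:R)).
rewrite -prodr_const -prodf_div; apply: eq_bigr => u _.
rewrite -[X in X - _](divff d_neq0) -mulrBl; congr (_ / _).
apply/eqP; rewrite -subr_eq opprK -(ereg u) -!sum1_card !natr_sum.
rewrite [X in _ + X](eq_bigl (fun w => e u w && (w \in W))); last first.
  by move=> w; rewrite inE andbC.
rewrite [X in _ + X]big_mkcondr -big_split /=.
rewrite [X in _ == X](eq_bigl (e u)); last by move=> w; rewrite inE.
by apply/eqP; apply: eq_bigr => w _; case: (w \in W); rewrite ?addr0 ?add0r.
Qed.

Lemma expr_in_degree (x : R) S w :
  (1 - x) ^+ in_degree S w = \prod_(u in S) (1 - (e u w)%:R * x).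
Proof.
rewrite /in_degree -prodr_const big_mkcond [RHS]big_mkcond /=.
apply: eq_bigr => u _; rewrite inE; case: (u \in S) => //=.
by case: (e u w); rewrite ?mul1r ?mul0r ?subr0.
Qed.

Lemma push_op_missed S w : w \notin S ->
  push_op (fun S' => (w \notin S')%:R) S = (1 - d%:R^-1) ^+ in_degree S w.
Proof.
move=> wS; have dis S' : [disjoint S' & [set w]] = (w \notin S').
  by rewrite disjoint_sym disjoints1.
rewrite expr_in_degree; have := @push_op_disjoint S [set w].
rewrite dis => /(_ wS).
rewrite (_ : (fun S' => _) = (fun S' => (w \notin S')%:R)); last first.
  by apply/funext => S'; rewrite dis.
move=> ->; apply: eq_bigr => u _; congr (1 - _%:R * _).
by rewrite -sum1dep_card big_mkcondr big_set1 /=; case: (e u w).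
Qed.

(** Two misses are negatively correlated: for each informed vertex,
    [1 - (a + b) <= (1 - a) * (1 - b)], where [a] and [b] are its chances of choosing [w] and
    [w']. *)
Lemma push_op_missed2 S w w' : w \notin S -> w' \notin S -> w != w' ->
  push_op (fun S' => (w \notin S')%:R * (w' \notin S')%:R) S <=
  (1 - d%:R^-1) ^+ in_degree S w * (1 - d%:R^-1) ^+ in_degree S w'.
Proof.
move=> wS w'S ww'.
have dis S' : [disjoint S' & [set w; w']] = (w \notin S') && (w' \notin S').
  by rewrite disjoint_sym disjoints_subset subUset !sub1set !inE.
have := @push_op_disjoint S [set w; w'].
rewrite dis wS w'S => /(_ isT).
rewrite (_ : (fun S' => _) = (fun S' => (w \notin S')%:R * (w' \notin S')%:R)); last first.
  by apply/funext => S'; rewrite dis -natrM mulnb.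
move=> ->; rewrite !expr_in_degree -big_split /=; apply: ler_prod => u _.
have dR : 0 < d%:R :> R by rewrite ltr0n.
apply/andP; split.
  rewrite subr_ge0 ler_pdivrMr // mul1r ler_nat -(ereg u) subset_leq_card //.
  by apply/subsetP => z; rewrite !inE => /andP[].
have -> : #|[set z in [set w; w'] | e u z]| = (e u w + e u w')%N.
  rewrite -sum1dep_card big_mkcondr big_setU1 ?inE //= big_set1.
  by case: (e u w); case: (e u w').
rewrite natrD mulrDl -subr_ge0.
have -> (a b : R) : (1 - a) * (1 - b) - (1 - (a + b)) = a * b by ring.
by rewrite !mulr_ge0 ?invr_ge0 ?ler0n.
Qed.

Lemma push_op_eq g h S : (forall S', S \subset S' -> g S' = h S') ->
  push_op g S = push_op h S.
Proof.
by move=> gh; apply/le_anti/andP; split; apply: push_op_le => S' SS' _; rewrite gh.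
Qed.

Lemma natr_cardC S : #|~: S|%:R = n%:R - #|S|%:R :> R.
Proof.
have := congr1 (fun k => k%:R : R) (cardsC S).
by rewrite /= card_ord natrD => <-; rewrite addrC addKr.
Qed.

(** Closed form of the expected number of uninformed vertices after one round from [S]; see
    [push_op_cardC]. *)
Definition exp_missed S : R := \sum_(w | w \notin S) (1 - d%:R^-1) ^+ in_degree S w.

Lemma cardC_sum S S' : S \subset S' ->
  #|~: S'|%:R = \sum_(w | w \notin S) (w \notin S')%:R :> R.
Proof.
move=> SS'; rewrite -sum1_card natr_sum big_mkcond [RHS]big_mkcond /=.
apply: eq_bigr => w _; rewrite inE; case: (boolP (w \in S')) => wS' /=.
  by case: ifP.
by rewrite (contra (subsetP SS' w) wS').
Qed.

Lemma push_op_cardC S : push_op (fun S' => #|~: S'|%:R) S = exp_missed S.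
Proof.
rewrite (@push_op_eq _ (fun S' => \sum_(w | w \notin S) (w \notin S')%:R)).
  by rewrite push_op_sum; apply: eq_bigr => w; exact: push_op_missed.
by move=> S'; exact: cardC_sum.
Qed.

Lemma onem_invd_ge0 : 0 <= 1 - d%:R^-1 :> R.
Proof. by rewrite subr_ge0 invf_le1 ?ltr0n // ler1n. Qed.

Lemma exp_missed_ge0 S : 0 <= exp_missed S.
Proof. by apply: sumr_ge0 => w _; rewrite exprn_ge0 ?onem_invd_ge0. Qed.

(** Expand the square over pairs: diagonal pairs sum to the mean, and the others are bounded by
    negative correlation. Hence the variance is at most the mean. *)
Lemma push_op_cardC_sqr S :
  push_op (fun S' => #|~: S'|%:R ^+ 2) S <= exp_missed S ^+ 2 + exp_missed S.
Proof.
rewrite (@push_op_eq _ (fun S' => \sum_(w | w \notin S) \sum_(w' | w' \notin S)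
   (w \notin S')%:R * (w' \notin S')%:R)); last first.
  move=> S' SS'; rewrite (cardC_sum SS') expr2 mulr_suml; apply: eq_bigr => w _.
  by rewrite mulr_sumr.
rewrite push_op_sum expr2 mulr_suml -big_split /=; apply: ler_sum => w wS.
rewrite push_op_sum mulr_sumr.
rewrite (bigD1 w) //= [X in _ <= X + _](bigD1 w) //=.
rewrite (_ : (fun S' => _) = (fun S' => (w \notin S')%:R)); last first.
  by apply/funext => S'; rewrite -natrM mulnb andbb.
rewrite push_op_missed // addrC lerD2r -[leLHS]add0r lerD //.
  by rewrite mulr_ge0 ?exprn_ge0 ?onem_invd_ge0.
by apply: ler_sum => w' /andP[w'S ww']; apply: push_op_missed2 => //; rewrite eq_sym.
Qed.

(* [1 / (k + x)] lies below its tangent at the mean [M] plus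
   [(x - M) ^ 2 / (k * (k + M) ^ 2)], and the variance is at most [M]. *)
Lemma push_op_inv_cardC (k : R) S : 0 < k ->
  push_op (fun S' => (k + #|~: S'|%:R)^-1) S <= (1 + k^-1) * (k + exp_missed S)^-1.
Proof.
move=> k0; set M := exp_missed S; have M0 : 0 <= M by exact: exp_missed_ge0.
have kM : 0 < k + M by rewrite ltr_pwDl.
(* Coefficients of the tangent plus its quadratic correction, expanded in powers of [x] so that only
   the first two moments enter. *)
pose a := (k + M)^-1 + M / (k + M) ^+ 2 + M ^+ 2 / (k * (k + M) ^+ 2).
pose b := - ((k + M) ^+ 2)^-1 - 2 * M / (k * (k + M) ^+ 2).
pose c := (k * (k + M) ^+ 2)^-1.
apply: (@le_trans _ _ (push_op (fun S' =>
    a + b * #|~: S'|%:R + c * #|~: S'|%:R ^+ 2) S)).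
  apply: push_op_le => S' _ _; set X := #|~: S'|%:R : R.
  have X0 : 0 <= X by rewrite ler0n.
  have kX : 0 < k + X by rewrite ltr_pwDl.
  have -> : a + b * X + c * X ^+ 2 = (k + X)^-1 + X * (X - M) ^+ 2 / (k * (k + X) * (k + M) ^+ 2).
    by rewrite /a /b /c; field; rewrite !gt_eqF.
  by rewrite lerDl divr_ge0 // mulr_ge0 ?sqr_ge0 // mulr_ge0 // ltW.
rewrite 2!push_opD 2!push_opZ push_op_cst push_op_cardC -/M.
apply: (@le_trans _ _ (a + b * M + c * (M ^+ 2 + M))).
  rewrite lerD2l ler_wpM2l ?push_op_cardC_sqr //.
  by rewrite invr_ge0 mulr_ge0 ?sqr_ge0 // ltW.
have -> : (1 + k^-1) / (k + M) = a + b * M + c * (M ^+ 2 + M) + (k + M) ^- 2.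
  by rewrite /a /b /c; field; rewrite !gt_eqF.
by rewrite lerDl invr_ge0 sqr_ge0.
Qed.

Hypothesis esym : forall u w, e u w = e w u.

Lemma in_degree_le S w : (in_degree S w <= d)%N.
Proof.
rewrite -(ereg w) subset_leq_card //; apply/subsetP => u.
by rewrite !inE esym => /andP[].
Qed.

Lemma in_degreeC S w : (in_degree S w + in_degree (~: S) w = d)%N.
Proof.
rewrite -(ereg w) -(cardsID S [set z | e w z]); congr (_ + _)%N; apply: eq_card => z.
  by rewrite !inE esym andbC.
by rewrite !inE esym.
Qed.

(** Double counting of the adjacent pairs whose first vertex lies in [S]. *)
Lemma sum_in_degree S : \sum_w (in_degree S w)%:R / d%:R = #|S|%:R :> R.
Proof.
rewrite -mulr_suml -natr_sum; apply: (canLR (mulfK d_neq0)); rewrite -natrM.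
congr (_%:R); under eq_bigr do rewrite /in_degree -sum1_card.
rewrite (exchange_big_dep (mem S)) /= => [|w u _]; last by rewrite inE => /andP[].
rewrite -sum_nat_const; apply: eq_bigr => u uS.
rewrite -(ereg u) -sum1_card; apply: eq_bigl => w.
by rewrite !inE uS.
Qed.

(** In-degrees are at most [d], so each uninformed vertex is missed with probability at least
    [(1 - 1 / d) ^ d], close to [1 / e]; this serves the lower tail. *)
Lemma exp_missed_ge S : (1 - d%:R^-1) ^+ d * #|~: S|%:R <= exp_missed S.
Proof.
rewrite -sum1_card natr_sum mulr_sumr /exp_missed [leLHS](eq_bigl (fun w => w \notin S)).
  apply: ler_sum => w _; rewrite mulr1 ler_wiXn2l ?onem_invd_ge0 ?in_degree_le // gerBl invr_ge0.
by move=> w; rewrite inE.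
Qed.

(** This is [y w - s / n]. *)
Definition deviation S (w : 'I_n) : R := (in_degree S w)%:R / d%:R - #|S|%:R / n%:R.

Lemma exp_missed_le S :
  exp_missed S <= \sum_(w | w \notin S) expR (- ((in_degree S w)%:R / d%:R)).
Proof.
apply: ler_sum => w _; rewrite -mulrN expRM_natl lerXn2r ?nnegrE ?expR_ge0 ?onem_invd_ge0 //.
exact: expR_ge1Dx.
Qed.

(** * Contraction and growth under a mean-square bound [b] on the deviation, later [C ^ 2 / d] *)

Variable b : R.
Hypothesis devb : forall S, \sum_w deviation S w ^+ 2 <= b * #|S|%:R.

(** Lets [devb] be applied to the complement, where its bound is proportional to [|U|]. *)
Lemma deviationC S w : deviation (~: S) w = - deviation S w.
Proof.
have nR : n%:R != 0 :> R by rewrite pnatr_eq0; case: n w => // [[]].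
have D := congr1 (fun k => k%:R : R) (in_degreeC S w).
move: D; rewrite /= natrD /deviation natr_cardC => D.
have -> : (in_degree (~: S) w)%:R = d%:R - (in_degree S w)%:R :> R by rewrite -D; ring.
by field; rewrite nR d_neq0.
Qed.

Lemma le_add_sqr_div (eta z : R) : 0 < eta -> z <= eta + z ^+ 2 / eta.
Proof.
move=> eta0; rewrite -(ler_pM2r eta0) mulrDl divfK ?gt_eqF //.
by nra.
Qed.

(* The second summand of the rate pays for the vertices whose neighbourhood deviates
   by more than [eta], which are few by Chebyshev's inequality. *)
Lemma exp_missed_contract (eta : R) S : 0 < eta ->
  exp_missed S <= (expR (eta - #|S|%:R / n%:R) + b / eta ^+ 2) * #|~: S|%:R.
Proof.
move=> eta0; apply: le_trans (exp_missed_le S) _.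
apply: (@le_trans _ _ (\sum_(w | w \notin S)
   (expR (eta - #|S|%:R / n%:R) + deviation S w ^+ 2 / eta ^+ 2))).
  apply: ler_sum => w _.
  have -> : (in_degree S w)%:R / d%:R = deviation S w + #|S|%:R / n%:R.
    by rewrite /deviation subrK.
  (* A deviation of at least [- eta] is paid by the exponential; otherwise the second summand is at
     least 1. *)
  have [le|lt] := leP (- deviation S w) eta.
    apply: ler_wpDr; first by rewrite mulr_ge0 ?invr_ge0 ?sqr_ge0.
    by rewrite ler_expR opprD lerD2r.
  apply: ler_wpDl; first exact: expR_ge0.
  apply: (@le_trans _ _ 1).
    rewrite expR_le1 oppr_le0 /deviation subrK mulr_ge0 ?invr_ge0 //.
  rewrite -expr_div_n -[deviation S w]opprK mulNr sqrrN exprn_ege1 //.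
  by rewrite ler_pdivlMr // mul1r ltW.
rewrite big_split /= -mulr_suml mulrDl lerD //.
  rewrite -[#|~: S|]sum1_card natr_sum mulr_sumr le_eqVlt; apply/orP; left.
  by apply/eqP; apply: eq_big => w; rewrite ?inE ?mulr1.
rewrite mulrAC ler_wpM2r ?invr_ge0 ?sqr_ge0 //; apply: le_trans (devb _).
under [leRHS]eq_bigr do rewrite deviationC sqrrN.
by rewrite [leLHS]big_mkcond ler_sum // => w _; case: ifP => // _; rewrite sqr_ge0.
Qed.

(** The values [y w] sum to [s], so [exp (- y) <= 1 - y + y ^ 2] gives [n - 2 * s] up to two losses:
    transmissions staying inside [S] (the sum of [y] over [S]) and collisions (the sum of
    [y ^ 2]). *)
Lemma exp_missed_growth (eta : R) S : 0 < eta ->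
  exp_missed S <= n%:R - 2 * #|S|%:R
     + #|S|%:R * (3 * (#|S|%:R / n%:R) + eta + 2 * b + b / eta).
Proof.
move=> eta0; apply: le_trans (exp_missed_le S) _.
set s := #|S|%:R : R; pose y w := (in_degree S w)%:R / d%:R : R.
have y0 w : 0 <= y w by rewrite divr_ge0.
have := devb S; set Z := \sum_w _ => ZS; rewrite -/s in ZS.
have s2n : n%:R * (s / n%:R) ^+ 2 = s ^+ 2 / n%:R.
  by have [->|nR] := eqVneq (n%:R : R) 0; [rewrite invr0 mul0r mulr0 | field].
have yE w : y w = deviation S w + s / n%:R by rewrite /deviation subrK.
have y2 : \sum_w y w ^+ 2 <= 2 * (s ^+ 2 / n%:R) + 2 * Z.
  apply: (@le_trans _ _ (\sum_w (2 * (s / n%:R) ^+ 2 + 2 * deviation S w ^+ 2))).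
    apply: ler_sum => w _; rewrite yE -subr_ge0.
    set p := deviation S w; set q := s / n%:R.
    have -> : 2 * q ^+ 2 + 2 * p ^+ 2 - (p + q) ^+ 2 = (p - q) ^+ 2 by ring.
    exact: sqr_ge0.
  rewrite big_split /= sumr_const card_ord -mulr_sumr -[2 * _ *+ n]mulr_natl [n%:R * _]mulrCA.
  by rewrite s2n.
have yS : \sum_(w in S) y w <= s ^+ 2 / n%:R + eta * s + Z / eta.
  apply: (@le_trans _ _ (\sum_(w in S) (s / n%:R + eta + deviation S w ^+ 2 / eta))).
    apply: ler_sum => w _; rewrite yE [leLHS]addrC -addrA lerD2l.
    exact: le_add_sqr_div.
  rewrite big_split /= sumr_const -/s -mulr_suml -[(_ + _) *+ #|S|]mulr_natl -/s mulrDr.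
  rewrite [s * eta]mulrC mulrA -expr2 lerD2l ler_wpM2r ?invr_ge0 ?(ltW eta0) //.
  by rewrite [leLHS]big_mkcond ler_sum // => w _; case: ifP => // _; rewrite sqr_ge0.
(* Passes through [1 / (1 + y)], using [(1 - y + y ^ 2) * (1 + y) = 1 + y ^ 3]. *)
apply: (@le_trans _ _ (\sum_(w | w \notin S) (1 - y w + y w ^+ 2))).
  apply: ler_sum => w _; have y0w := y0 w.
  rewrite expRN -/(y w).
  have p1 : 0 < 1 + y w by rewrite ltr_pwDl.
  apply: (@le_trans _ _ (1 + y w)^-1).
    by rewrite lef_pV2 ?posrE ?expR_gt0 // expR_ge1Dx.
  rewrite -div1r ler_pdivrMr //.
  have -> : (1 - y w + y w ^+ 2) * (1 + y w) = 1 + y w ^+ 3 by ring.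
  by rewrite lerDl exprn_ge0.
rewrite big_split sumrB /=.
have sumy : \sum_(w | w \notin S) y w = s - \sum_(w in S) y w.
  have := sum_in_degree S; rewrite (bigID (mem S)) /= -/s => <-.
  by rewrite addrAC subrr add0r.
have card1 : \sum_(w | w \notin S) (1 : R) = n%:R - s.
  rewrite -natr_cardC -sum1_card natr_sum; apply: eq_bigl => w; by rewrite inE.
have y2' : \sum_(w | w \notin S) y w ^+ 2 <= \sum_w y w ^+ 2.
  by rewrite [leLHS]big_mkcond ler_sum // => w _; case: ifP => // _; rewrite sqr_ge0.
have Ze : Z / eta <= b * s / eta by rewrite ler_wpM2r ?invr_ge0 ?(ltW eta0).
rewrite sumy card1.
have -> : s * (3 * (s / n%:R) + eta + 2 * b + b / eta) =
   3 * (s ^+ 2 / n%:R) + eta * s + 2 * (b * s) + b * s / eta by ring.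
lra.
Qed.

(* [1 / x] lies below its chord on [s, 2 s], which turns the expected growth into a
   bound on the expectation of [1 / s]. *)
Lemma push_op_inv_card (eta : R) S : 0 < eta ->
  push_op (fun S' => #|S'|%:R^-1) S <=
  (1 + (3 * (#|S|%:R / n%:R) + eta + 2 * b + b / eta)) / 2 * #|S|%:R^-1.
Proof.
(* An empty [S] stays empty, and both sides vanish because the inverse of 0 is 0. *)
move=> eta0; have [S0|S0] := posnP #|S|.
  rewrite S0 invr0 mulr0 -[leRHS](push_op_cst 0 S); apply: push_op_le.
  by move=> S' _; rewrite S0 muln0 leqn0 => /eqP ->; rewrite invr0.
have := exp_missed_growth S eta0; set c := 3 * _ + _ + _ + _; set s := #|S|%:R : R.
have s0 : 0 < s by rewrite ltr0n.
move=> Mle.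
(* The chord, rewritten in the number of uninformed vertices, whose expectation is [exp_missed]. *)
apply: (@le_trans _ _ (push_op (fun S' =>
   ((2 * s)^-1 + (2 * s - n%:R) / (2 * s ^+ 2)) + (2 * s ^+ 2)^-1 * #|~: S'|%:R) S)).
  apply: push_op_le => S' SS' S'le.
  rewrite natr_cardC; set s' := #|S'|%:R : R.
  have ss' : s <= s' by rewrite ler_nat subset_leq_card.
  have s's : s' <= 2 * s by rewrite -natrM ler_nat.
  have s'0 : 0 < s' by exact: lt_le_trans ss'.
  rewrite -subr_ge0.
  have -> : (2 * s)^-1 + (2 * s - n%:R) / (2 * s ^+ 2) + (2 * s ^+ 2)^-1 * (n%:R - s') - s'^-1
     = (s' - s) * (2 * s - s') / (2 * s ^+ 2 * s').
    by field; rewrite !gt_eqF.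
  by rewrite divr_ge0 ?mulr_ge0 ?subr_ge0 ?sqr_ge0 // ltW.
rewrite push_opD push_opZ push_op_cst push_op_cardC -subr_ge0.
have -> : (1 + c) / 2 / s - ((2 * s)^-1 + (2 * s - n%:R) / (2 * s ^+ 2) +
    (2 * s ^+ 2)^-1 * exp_missed S)
  = (n%:R - 2 * s + s * c - exp_missed S) / (2 * s ^+ 2).
  by field; rewrite gt_eqF.
by rewrite divr_ge0 ?subr_ge0 ?mulr_ge0 ?sqr_ge0.
Qed.

Lemma push_op_card S : push_op (fun S' => #|S'|%:R) S <= 2 * #|S|%:R.
Proof.
rewrite -[leRHS](push_op_cst _ S); apply: push_op_le => S' _.
by rewrite -natrM ler_nat.
Qed.

End PushOperator.

(** * Iterated rounds *)

Section PushChain.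
Variables (R : realType) (n : nat) (e : rel 'I_n).
Implicit Types (S : {set 'I_n}) (g h : {set 'I_n} -> R) (v : 'I_n) (t : nat).
Local Notation K := (push_op e).

(** Duality: rounds move from the distribution to the test function, so potentials can be handled
    from any starting set. *)
Lemma push_dist_iter v t k g :
  \sum_S push_dist R e v t S * iter k K g S = \sum_S push_dist R e v (t + k) S * g S.
Proof.
elim: k t => [|k IHk] t; first by rewrite addn0.
rewrite addnS -addSn -IHk /=.
rewrite (eq_bigr (fun S => \sum_S' push_dist R e v t S * push_kernel R e S S' * iter k K g S')).
  by rewrite exchange_big; apply: eq_bigr => S' _; rewrite mulr_suml.
by move=> S _; rewrite mulr_sumr; apply: eq_bigr => S' _; rewrite mulrA.
Qed.

Lemma probT_le_iter v t :
  probT_le R e v t = iter t K (fun S => (S == [set: 'I_n])%:R) [set v].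
Proof.
transitivity (\sum_S push_dist R e v t S * (S == [set: 'I_n])%:R).
  rewrite (bigD1 [set: 'I_n]) //= eqxx mulr1 big1 ?addr0 // => S /negbTE ->.
  by rewrite mulr0.
rewrite -[t]/(0 + t)%N -push_dist_iter (bigD1 [set v]) //= eqxx mul1r.
by rewrite big1 ?addr0 // => S /negbTE ->; rewrite mul0r.
Qed.

Lemma iter_push_op_le t g h S :
  (forall S', S \subset S' -> g S' <= h S') -> iter t K g S <= iter t K h S.
Proof.
elim: t S => [|t IHt] S gh /=; first exact: gh.
apply: push_op_le => S' SS' _; apply: IHt => S'' S'S''.
by apply: gh; apply: subset_trans S'S''.
Qed.

(** The region [D] where one round contracts is upward closed, so the growing informed set never
    leaves it. *)
Lemma iter_push_op_contract (D : pred {set 'I_n}) (c : R) g t S :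
  (forall S S', D S -> S \subset S' -> D S') -> 0 <= c ->
  (forall S, D S -> K g S <= c * g S) -> D S -> iter t K g S <= c ^+ t * g S.
Proof.
move=> Dup c0 gc; elim: t S => [|t IHt] S DS /=; first by rewrite expr0 mul1r.
apply: (@le_trans _ _ (K (fun S' => c ^+ t * g S') S)).
  by apply: push_op_le => S' SS' _; apply: IHt; apply: Dup SS'.
by rewrite push_opZ exprSr -mulrA ler_wpM2l ?exprn_ge0 // gc.
Qed.

Lemma iter_push_opZ t a g S : iter t K (fun S' => a * g S') S = a * iter t K g S.
Proof.
have -> : iter t K (fun S' => a * g S') = (fun S' => a * iter t K g S').
  by elim: t => // t IHt; apply/funext => S'; rewrite iterS IHt push_opZ.
by [].
Qed.

Section Regular.
Variable d : nat.
Hypotheses (esym : forall u w, e u w = e w u) (ereg : regular e d) (d_gt0 : (0 < d)%N).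

Lemma iter_push_op_cst (c : R) t S : iter t K (fun=> c) S = c.
Proof.
have -> : iter t K (fun=> c) = (fun=> c).
  elim: t => // t IHt; apply/funext => S'.
  by rewrite iterS IHt; apply: push_op_cst ereg d_gt0 _ _.
by [].
Qed.

Lemma iter_push_opD t g h S :
  iter t K (fun S' => g S' + h S') S = iter t K g S + iter t K h S.
Proof.
have -> : iter t K (fun S' => g S' + h S') = (fun S' => iter t K g S' + iter t K h S').
  by elim: t => // t IHt; apply/funext => S'; rewrite iterS IHt push_opD.
by [].
Qed.

(** The full set is absorbing. *)
Lemma probT_le_homo v t t' : (t <= t')%N -> probT_le R e v t <= probT_le R e v t'.
Proof.
move=> /subnK <-; elim: (t' - t)%N => // k /le_trans; apply.
rewrite addSn !probT_le_iter iterSr; apply: iter_push_op_le => S _.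
rewrite -[leLHS](push_op_cst ereg d_gt0 _ S); apply: push_op_le => S' SS' _.
by case: eqP SS' => [->|_ _]; rewrite ?ler0n // subTset => ->.
Qed.

Lemma sum_probT_eq v t : \sum_(i < t.+1) probT_eq R e v i = probT_le R e v t.
Proof.
elim: t => [|t IHt]; first by rewrite big_ord1.
by rewrite big_ord_recr /= IHt addrC subrK.
Qed.

(** An index up to [truncn (L + r)] outside the window must lie below [L - r], hence is at most [m]
    and is accounted for by [probT_le v m]. *)
Lemma probT_within_ge v (L r : R) (m : nat) : 0 <= L + r ->
  (m <= Num.truncn (L + r))%N -> (forall t : nat, t%:R < L - r -> (t <= m)%N) ->
  probT_le R e v (Num.truncn (L + r)) - probT_le R e v m <= probT_within e v L r.
Proof.
move=> Lr0; set M := Num.truncn _ => mM mP.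
have peq0 t : 0 <= probT_eq R e v t.
  case: t => [|t] /=; last by rewrite subr_ge0 probT_le_homo.
  by rewrite /probT_le /= ler0n.
rewrite -!sum_probT_eq (bigID (fun t : 'I_M.+1 => `|t%:R - L| <= r)) /=.
rewrite /probT_within -/M lerBlDr lerD2l.
rewrite (big_ord_widen M.+1 (probT_eq R e v)) //.
rewrite big_mkcond [leRHS]big_mkcond; apply: ler_sum => t _.
case: ifP => [nin|_]; last by case: ifP.
rewrite ifT // ltnS mP //.
have : t%:R <= L + r.
  apply: (@le_trans _ _ M%:R); first by rewrite ler_nat -ltnS.
  by have /andP[] := truncn_itv Lr0.
by move: nin; rewrite ler_norml; lra.
Qed.

(* The three error terms: informing a [theta] fraction, then a [1 - theta] fraction,
   then everyone. *)
Lemma probT_le_upper v (b eta theta : R) t1 t2 t3 :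
  0 <= b -> 0 < eta -> 0 < theta ->
  (forall S, \sum_w deviation R e d S w ^+ 2 <= b * #|S|%:R) ->
  1 - (n%:R * ((1 + (3 * theta + eta + 2 * b + b / eta)) / 2) ^+ t1
       + (expR (eta - theta) + b / eta ^+ 2) ^+ t2 / theta
       + n%:R * (expR (eta - (1 - theta)) + b / eta ^+ 2) ^+ t3)
  <= probT_le R e v (t1 + t2 + t3).
Proof.
move=> b0 eta0 theta0 devb.
set c1 := _ / 2; set c := fun x => expR (eta - x) + b / eta ^+ 2.
have c_ge0 x : 0 <= c x by rewrite addr_ge0 ?expR_ge0 // divr_ge0 // sqr_ge0.
have n_gt0 : 0 < n%:R :> R by rewrite ltr0n; case: n v => // [[]].
have c1_ge0 : 0 <= c1.
  have be : 0 <= b / eta by rewrite divr_ge0 // ltW.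
  by rewrite /c1; lra.
(* Once an [x] fraction is informed it stays so, and every later round contracts [|U|] by [c x]. *)
have contractC x t S : x * n%:R <= #|S|%:R ->
    iter t K (fun S' => #|~: S'|%:R) S <= c x ^+ t * n%:R.
  move=> xS; apply: (@le_trans _ _ (c x ^+ t * #|~: S|%:R)); last first.
    by rewrite ler_wpM2l ?exprn_ge0 // natr_cardC gerBl.
  apply: (@iter_push_op_contract (fun S => x * n%:R <= #|S|%:R)) => //.
    by move=> S1 S2 /le_trans + S12; apply; rewrite ler_nat subset_leq_card.
  move=> S1 xS1; rewrite (push_op_cardC R ereg d_gt0).
  apply: le_trans (exp_missed_contract ereg d_gt0 esym devb _ eta0) _.
  by rewrite ler_wpM2r // lerD2r ler_expR lerD2l lerN2 ler_pdivlMr.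
pose bad1 S : R := (#|S|%:R < theta * n%:R)%R%:R.
pose bad2 S : R := (#|S|%:R < (1 - theta) * n%:R)%R%:R.
pose bad3 S : R := (S != [set: 'I_n])%:R.
have iter_le1 t g S : (forall S', g S' <= 1) -> iter t K g S <= 1.
  by move=> g1; rewrite -[leRHS](iter_push_op_cst _ t S); apply: iter_push_op_le.
have phase3 S : iter t3 K bad3 S <= n%:R * c (1 - theta) ^+ t3 + bad2 S.
  rewrite [bad2 S]/bad2; case: ltP => hS.
    rewrite -[leLHS]add0r lerD ?iter_le1 // ?mulr_ge0 ?exprn_ge0 //.
    by move=> S'; rewrite /bad3; case: eqP.
  rewrite addr0 mulrC; apply: le_trans (contractC _ t3 S hS).
  apply: iter_push_op_le => S' _; rewrite /bad3 ler_nat.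
  case: eqP => //= /eqP; rewrite -(inj_eq (can_inj (@setCK _))) setCT.
  by rewrite -card_gt0.
have phase2 S : iter t2 K bad2 S <= c theta ^+ t2 / theta + bad1 S.
  rewrite [bad1 S]/bad1; case: ltP => hS.
    rewrite -[leLHS]add0r lerD ?iter_le1 ?divr_ge0 ?exprn_ge0 ?(ltW theta0) //.
    by move=> S'; rewrite /bad2; case: ltP.
  have tn : 0 < theta * n%:R by rewrite mulr_gt0.
  (* Markov's inequality: failing the target leaves more than [theta * n] vertices uninformed. *)
  apply: (@le_trans _ _ (iter t2 K (fun S' => (theta * n%:R)^-1 * #|~: S'|%:R) S)).
    apply: iter_push_op_le => S' _; rewrite /bad2 [leRHS]mulrC; case: ltP => hS'.
      by rewrite ler_pdivlMr // mul1r natr_cardC; lra.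
    by rewrite divr_ge0 // ltW.
  rewrite iter_push_opZ addr0 mulrC ler_pdivrMr //.
  have -> : c theta ^+ t2 / theta * (theta * n%:R) = c theta ^+ t2 * n%:R.
    by rewrite mulrA divfK ?gt_eqF.
  exact: contractC.
have phase1 : iter t1 K bad1 [set v] <= n%:R * c1 ^+ t1.
  (* The rate [c1] holds only below the fraction [theta]; cutting [1 / s] to 0 beyond it makes the
     contraction hold everywhere. *)
  pose g S : R := if #|S|%:R < theta * n%:R then #|S|%:R^-1 else 0.
  apply: (@le_trans _ _ (iter t1 K (fun S' => n%:R * g S') [set v])).
    apply: iter_push_op_le => S' vS'; rewrite /bad1 /g; case: ltP => _; last by rewrite mulr0.
    have S'0 : (0 < #|S'|)%N by rewrite (leq_trans _ (subset_leq_card vS')) ?cards1.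
    by rewrite ler_pdivlMr ?ltr0n // mul1r ler_nat -[leqRHS](card_ord n) max_card.
  rewrite iter_push_opZ ler_wpM2l //.
  apply: (@le_trans _ _ (c1 ^+ t1 * g [set v])).
    apply: (@iter_push_op_contract predT) => // S _.
    have [hS|hS] := ltP #|S|%:R (theta * n%:R); last first.
      rewrite [g S]/g ltNge hS mulr0 -[leRHS](push_op_cst ereg d_gt0 0 S).
      apply: push_op_le => S' SS' _; rewrite /g ltNge (le_trans hS) //.
      by rewrite ler_nat subset_leq_card.
    rewrite [g S]/g hS; apply: (@le_trans _ _ (K (fun S' => #|S'|%:R^-1) S)).
      by apply: push_op_le => S' _ _; rewrite /g; case: ifP.
    apply: le_trans (push_op_inv_card ereg d_gt0 devb _ eta0) _.
    rewrite ler_wpM2r ?invr_ge0 // ler_pM2r ?invr_gt0 //.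
    have : #|S|%:R / n%:R <= theta by rewrite ler_pdivrMr // ltW.
    lra.
  rewrite -[leRHS]mulr1 ler_wpM2l ?exprn_ge0 // /g cards1 invr1.
  by case: ifP.
have -> : probT_le R e v (t1 + t2 + t3) = 1 - iter (t1 + t2 + t3) K bad3 [set v].
  have -> : bad3 = fun S => 1 + (-1) * (S == [set: 'I_n])%:R.
    by apply/funext => S; rewrite /bad3; case: eqP => _ /=; ring.
  rewrite iter_push_opD iter_push_op_cst iter_push_opZ -probT_le_iter; ring.
rewrite lerD2l lerN2 -addnA !iterD.
apply: (@le_trans _ _ (iter t1 K (fun S => (n%:R * c (1 - theta) ^+ t3 +
    c theta ^+ t2 / theta) + bad1 S) [set v])); last first.
  by rewrite iter_push_opD iter_push_op_cst; lra.
apply: iter_push_op_le => S _.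
apply: (@le_trans _ _ (iter t2 K (fun S => n%:R * c (1 - theta) ^+ t3 + bad2 S) S)).
  by apply: iter_push_op_le => S' _; exact: phase3.
by rewrite iter_push_opD iter_push_op_cst -addrA lerD2l.
Qed.

(** The mean of [s] after [t1] rounds is at most [2 ^ t1], so by Markov half the vertices are rarely
    informed by then. Otherwise [k / (k + |U|)] is at most [2 * k / n], grows by at most [c] per
    round, and must reach 1 on the full set. *)
Lemma probT_le_lower v (k : R) t1 t2 : 0 < k -> (1 < d)%N ->
  probT_le R e v (t1 + t2) <=
  2 * 2 ^+ t1 / n%:R + 2 * k * expR (1 + k^-1 + (d%:R - 1)^-1) ^+ t2 / n%:R.
Proof.
move=> k0 d1; set c := expR _.
have n_gt0 : 0 < n%:R :> R by rewrite ltr0n; case: n v => // [[]].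
have d1R : 0 < d%:R - 1 :> R by rewrite subr_gt0 ltr1n.
have dR : 0 < d%:R :> R by rewrite ltr0n.
have q0 : 0 < 1 - d%:R^-1 :> R by rewrite subr_gt0 invf_lt1 // ltr1n.
have kU S : 0 < k + #|~: S|%:R by rewrite ltr_pwDl.
(* The inverse of [1 - 1 / d] is [1 + 1 / (d - 1)], at most [exp (1 / (d - 1))]. *)
have qe : expR (- (1 + (d%:R - 1)^-1)) <= (1 - d%:R^-1) ^+ d :> R.
  have -> : 1 + (d%:R - 1)^-1 = d%:R * (d%:R - 1)^-1 :> R.
    by field; rewrite gt_eqF.
  rewrite -mulrN expRM_natl lerXn2r ?nnegrE ?expR_ge0 ?(ltW q0) //.
  rewrite expRN -[leRHS]invrK lef_pV2 ?posrE ?expR_gt0 ?invr_gt0 //.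
  have -> : (1 - d%:R^-1)^-1 = 1 + (d%:R - 1)^-1 :> R.
    by field; rewrite !gt_eqF.
  exact: expR_ge1Dx.
have contract S : K (fun S' => (k + #|~: S'|%:R)^-1) S <= c * (k + #|~: S|%:R)^-1.
  apply: le_trans (push_op_inv_cardC ereg d_gt0 S k0) _.
  have kM : 0 < k + exp_missed R e d S.
    by rewrite ltr_pwDl // (exp_missed_ge0 R e d_gt0).
  rewrite ler_pdivrMr // mulrAC ler_pdivlMr //.
  (* The first factor absorbs the variance term [1 + 1 / k], the second the decrease of the mean of
     [|U|]. *)
  have -> : c = expR k^-1 * expR (1 + (d%:R - 1)^-1).
    by rewrite -expRD /c; congr expR; ring.
  rewrite -mulrA; apply: ler_pM; rewrite ?expR_ge1Dx //.
  - by rewrite addr_ge0 ?invr_ge0 // ltW.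
  - exact: ltW.
  rewrite mulrC -ler_pdivrMr ?expR_gt0 // -expRN.
  rewrite mulrDl lerD //.
    rewrite -[leRHS]mulr1 ler_wpM2l ?(ltW k0) // expR_le1 oppr_le0.
    by rewrite addr_ge0 ?invr_ge0 // ltW.
  apply: le_trans (exp_missed_ge R ereg d_gt0 esym S).
  by rewrite mulrC ler_wpM2r.
rewrite probT_le_iter iterD.
pose D := 2 * k * c ^+ t2 / n%:R.
have D0 : 0 <= D by rewrite divr_ge0 // !mulr_ge0 ?exprn_ge0 ?expR_ge0 // ltW.
(* Linear in [|S|], so the first [t1] rounds need only its mean; the slope [2 / n] makes the bound
   trivial past [n / 2]. *)
have half S : iter t2 K (fun S => (S == [set: 'I_n])%:R) S <= D + (2 / n%:R) * #|S|%:R.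
  have [hS|hS] := leP (#|S|%:R : R) (n%:R / 2).
    rewrite -[leLHS]addr0 lerD ?mulr_ge0 ?invr_ge0 //.
    apply: (@le_trans _ _ (iter t2 K (fun S' => k * (k + #|~: S'|%:R)^-1) S)).
      apply: iter_push_op_le => S' _; case: eqP => [->|_].
        by rewrite setCT cards0 addr0 divff ?gt_eqF.
      by rewrite divr_ge0 ?ltW.
    rewrite iter_push_opZ /D -[2 * k]mulrC -!mulrA ler_pM2l //.
    apply: (@le_trans _ _ (c ^+ t2 * (k + #|~: S|%:R)^-1)).
      by apply: (@iter_push_op_contract predT) => //; rewrite expR_ge0.
    rewrite mulrCA ler_wpM2l ?exprn_ge0 ?expR_ge0 //.
    rewrite -[leRHS]invrK lef_pV2 ?posrE ?invr_gt0 ?mulr_gt0 ?invr_gt0 //.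
    by rewrite invfM invrK mulrC natr_cardC; lra.
  apply: (@le_trans _ _ 1).
    rewrite -[leRHS](iter_push_op_cst _ t2 S); apply: iter_push_op_le => S' _.
    by case: eqP.
  apply: ler_wpDl => //; rewrite mulrAC ler_pdivlMr //; lra.
apply: (@le_trans _ _ (iter t1 K (fun S => D + 2 / n%:R * #|S|%:R) [set v])).
  by apply: iter_push_op_le => S _; exact: half.
rewrite iter_push_opD iter_push_op_cst iter_push_opZ addrC lerD2r mulrAC.
rewrite ler_wpM2r ?invr_ge0 // ler_pM2l //.
apply: (@le_trans _ _ (2 ^+ t1 * #|[set v]|%:R)); last by rewrite cards1 mulr1.
apply: (@iter_push_op_contract predT) => // S _.
exact: (push_op_card R ereg d_gt0 S).
Qed.

End Regular.
End PushChain.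

(** * Choice of the constants *)

Section Asymptotics.
Variable R : realType.

Lemma expR_decay_le (A w delta : R) : 0 <= A -> 0 < w -> 0 < delta ->
  exists X, forall x, X <= x -> A * expR (- (w * x)) <= delta.
Proof.
move=> A0 w0 delta0; exists (A / (delta * w)) => x.
rewrite ler_pdivrMr ?mulr_gt0 // => Ax.
rewrite expRN ler_pdivrMr ?expR_gt0 //.
apply: (@le_trans _ _ (delta * (1 + w * x))); last first.
  by rewrite ler_wpM2l ?(ltW delta0) // expR_ge1Dx.
by lra.
Qed.

Lemma expr_le_expR (c w y : R) (t : nat) : 0 <= c -> c <= expR (- w) -> 0 <= w ->
  y <= t%:R -> c ^+ t <= expR (- (w * y)).
Proof.
move=> c0 cw w0 yt; apply: (@le_trans _ _ (expR (- w) ^+ t)).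
  by rewrite lerXn2r ?nnegrE ?expR_ge0.
by rewrite -expRM_natl ler_expR mulrN lerN2 mulrC ler_wpM2r.
Qed.

(** Divide [discrepancy_le] by [d ^ 2] and use [lam ^ 2 <= C ^ 2 * d]; [C ^ 2 < d] ensures
    [lam < d]. *)
Lemma deviation_le n (e : rel 'I_n) (d : nat) (C lam : R) (S : {set 'I_n}) :
  0 <= C -> simple_graph e -> regular e d -> second_eig_abs (adjmx R e) lam ->
  lam <= C * Num.sqrt d%:R -> C ^+ 2 < d%:R ->
  \sum_w deviation R e d S w ^+ 2 <= C ^+ 2 / d%:R * #|S|%:R.
Proof.
move=> C0 esimp ereg eeig lamC Cd.
have d0 : 0 < d%:R :> R by apply: le_lt_trans Cd; exact: sqr_ge0.
have lam0 : 0 <= lam by case: eeig => s [_ _ ->]; exact: bigmax_ge_id.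
have lam2 : lam ^+ 2 <= C ^+ 2 * d%:R.
  rewrite -[in leRHS](sqr_sqrtr (ler0n R d)) -exprMn.
  by rewrite lerXn2r ?nnegrE // (le_trans lam0).
have lamd : lam < d%:R.
  rewrite -(@ltr_pXn2r _ 2) ?nnegrE //; apply: le_lt_trans lam2 _.
  by rewrite expr2 ltr_pM2r.
have := discrepancy_le S esimp ereg eeig lamd.
rewrite (eq_bigr (fun w => d%:R ^+ 2 * deviation R e d S w ^+ 2)); last first.
  by move=> w _; rewrite -exprMn /deviation mulrBr [d%:R * (_ / d%:R)]mulrC divfK // gt_eqF.
rewrite -mulr_sumr => H.
have {}H := le_trans H (ler_wpM2r (ler0n R #|S|) lam2).
rewrite -(ler_pM2l (exprn_gt0 2 d0)); apply: le_trans H _.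
rewrite le_eqVlt; apply/orP; left; apply/eqP; field.
by rewrite gt_eqF.
Qed.

(** The phases get [(ln 2)^-1 + eps / 4], [eps / 4] and [1 + eps / 4] times [ln n] rounds. The first
    and third must beat a factor [n], so [w1] and [w3] lie slightly below [ln 2] and 1; [w2] need
    only be positive. [beta] is chosen after [theta] and [eta]. *)
Lemma phase_rates (eps : R) : 0 < eps -> exists theta eta beta w1 w2 w3 : R,
  [/\ [/\ 0 < theta, 0 < eta & 0 < beta],
      [/\ 1 < w1 * ((ln 2)^-1 + eps / 4), 0 < w2 & 1 < w3 * (1 + eps / 4)] &
      forall b, 0 <= b -> b <= beta ->
      [/\ (1 + (3 * theta + eta + 2 * b + b / eta)) / 2 <= expR (- w1),
          expR (eta - theta) + b / eta ^+ 2 <= expR (- w2) &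
          expR (eta - (1 - theta)) + b / eta ^+ 2 <= expR (- w3)]].
Proof.
move=> eps0.
have ln2 : 0 < ln 2 :> R by rewrite ln_gt0 // ltr1n.
set a1 := (ln 2)^-1 + eps / 4; set a3 := 1 + eps / 4.
have il2 : 0 < (ln 2)^-1 :> R by rewrite invr_gt0.
have a1_gt0 : 0 < a1 by rewrite /a1; lra.
have a3_gt0 : 0 < a3 by rewrite /a3; lra.
have a1ln : a1^-1 < ln 2 by rewrite -[ltRHS]invrK ltf_pV2 ?posrE // /a1; lra.
have a3ln : a3^-1 < 1 by rewrite invf_lt1 // /a3; lra.
have [w1 [w1a w1ln]] : exists w1, a1^-1 < w1 /\ w1 < ln 2.
  by exists ((a1^-1 + ln 2) / 2); split; lra.
have [w3 [w3a w31]] : exists w3, a3^-1 < w3 /\ w3 < 1.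
  by exists ((a3^-1 + 1) / 2); split; lra.
(* The room left in the first rate, positive because [w1 < ln 2]. *)
have [r1 r1E] : exists r1, r1 = 2 * expR (- w1) - 1 by eexists.
have r1_gt0 : 0 < r1.
  rewrite r1E subr_gt0 -ltr_pdivrMl // mulr1 -[ltLHS]lnK ?posrE ?invr_gt0 //.
  by rewrite ltr_expR lnV ?posrE // ltrN2.
(* With [eta = theta / 2], the first bound gives [3 * theta + eta <= r1 / 2], and the second gives
   [eta - (1 - theta) <= - (1 + w3) / 2]. *)
have [theta [theta_gt0 theta1 theta3]] :
    exists theta, [/\ 0 < theta, theta <= r1 / 8 & theta <= (1 - w3) / 3].
  exists (Num.min (r1 / 8) ((1 - w3) / 3)); rewrite !ge_min !lexx orbT lt_min.
  by split => //; apply/andP; split; lra.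
pose eta := theta / 2; have eta_gt0 : 0 < eta by rewrite divr_gt0.
pose r2 := expR (- (theta / 4)) - expR (- (theta / 2)).
have r2_gt0 : 0 < r2 by rewrite subr_gt0 ltr_expR; lra.
pose r3 := expR (- w3) - expR (- ((1 + w3) / 2)).
have r3_gt0 : 0 < r3 by rewrite subr_gt0 ltr_expR; lra.
have ieta : 0 < eta^-1 by rewrite invr_gt0.
have eta2 : 0 < 2 + eta^-1 by rewrite addr_gt0.
exists theta, eta, (Num.min (r1 / 2 / (2 + eta^-1)) (Num.min r2 r3 * eta ^+ 2)).
exists w1, (theta / 4), w3; split.
- split => //; rewrite lt_min; apply/andP; split; first by rewrite !divr_gt0.
  by rewrite mulr_gt0 ?exprn_gt0 // lt_min r2_gt0.
- by split; [rewrite -ltr_pdivrMr // div1r | rewrite divr_gt0 | rewrite -ltr_pdivrMr // div1r].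
move=> b b0; rewrite le_min ler_pdivlMr // => /andP[b1].
rewrite -ler_pdivrMr ?exprn_gt0 // le_min => /andP[b2 b3]; split.
- have etaE : 2 * eta = theta by rewrite /eta; field.
  rewrite mulrDr in b1; clear -b1 theta1 etaE r1E r1_gt0; lra.
- have -> : eta - theta = - (theta / 2) by rewrite /eta; field.
  by apply: le_trans (lerD (lexx _) b2) _; rewrite /r2 addrC subrK.
have : expR (eta - (1 - theta)) <= expR (- ((1 + w3) / 2)).
  by rewrite ler_expR /eta; clear -theta3; lra.
by move=> /lerD/(_ b3)/le_trans; apply; rewrite /r3 addrC subrK.
Qed.

(** Each of the three errors of [probT_le_upper] is made at most [delta / 3]. *)
Lemma probT_le_upper_tail (C eps delta : R) :
  0 < C -> 0 < eps -> 0 < delta -> exists X : R,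
  forall n (e : rel 'I_n) (d : nat) (lam : R) (v : 'I_n),
    simple_graph e -> regular e d -> second_eig_abs (adjmx R e) lam ->
    lam <= C * Num.sqrt d%:R -> X <= ln n%:R -> X <= d%:R ->
    1 - delta <= probT_le R e v
      (Num.truncn (ln n%:R / ln 2 + ln n%:R + eps * ln n%:R)).
Proof.
move=> C0 eps0 delta0.
have ln2 : 0 < ln 2 :> R by rewrite ln_gt0 // ltr1n.
have [theta [eta [beta [w1 [w2 [w3 [[theta_gt0 eta_gt0 beta_gt0] + rates]]]]]]] :=
  phase_rates eps0.
pose a1 := (ln 2)^-1 + eps / 4 : R; pose a2 := eps / 4; pose a3 := 1 + eps / 4 : R.
rewrite -/a1 -/a3 => -[w1a w2_gt0 w3a].
have a1_gt0 : 0 < a1 by rewrite addr_gt0 ?invr_gt0 ?divr_gt0.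
have a2_gt0 : 0 < a2 by rewrite divr_gt0.
have a3_gt0 : 0 < a3 by rewrite addr_gt0 ?divr_gt0.
have w1_gt0 : 0 < w1 by rewrite -(pmulr_lgt0 w1 a1_gt0); apply: lt_trans w1a.
have w3_gt0 : 0 < w3 by rewrite -(pmulr_lgt0 w3 a3_gt0); apply: lt_trans w3a.
rewrite -subr_gt0 in w1a; rewrite -subr_gt0 in w3a.
have d3 : 0 < delta / 3 by rewrite divr_gt0.
have itheta : 0 <= theta^-1 by rewrite invr_ge0 ltW.
have [X1 X1P] := expR_decay_le ler01 w1a d3.
have [X2 X2P] := expR_decay_le itheta (mulr_gt0 w2_gt0 a2_gt0) d3.
have [X3 X3P] := expR_decay_le ler01 w3a d3.
(* [12 / eps] makes [eps * l / 4] at least 3, the cost of rounding three phases up; the last two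
   entries give [C ^ 2 / d <= beta] and [C ^ 2 < d]. *)
exists (Num.max X1 (Num.max X2 (Num.max X3 (Num.max (12 / eps)
  (Num.max (C ^+ 2 / beta) (C ^+ 2 + 1)))))).
move=> n e d lam v esimp ereg eeig lamC.
have n_gt0 : 0 < n%:R :> R by rewrite ltr0n; case: n v {e esimp ereg eeig} => // [[]].
rewrite !ge_max; set l := ln n%:R.
move=> /andP[l1 /andP[l2 /andP[l3 /andP[l4 /andP[_ l6]]]]].
move=> /andP[_ /andP[_ /andP[_ /andP[_ /andP[dX5 dX6]]]]].
have Cd : C ^+ 2 < d%:R by apply: lt_le_trans dX6; rewrite ltrDl.
have l_gt0 : 0 < l by apply: lt_le_trans l6; rewrite ltr_wpDl ?sqr_ge0.
have dR : 0 < d%:R :> R by apply: le_lt_trans Cd; exact: sqr_ge0.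
have d_gt0 : (0 < d)%N by rewrite -(ltr0n R).
have b0 : 0 <= C ^+ 2 / d%:R by rewrite divr_ge0 ?sqr_ge0.
have bbeta : C ^+ 2 / d%:R <= beta by rewrite ler_pdivrMr // mulrC -ler_pdivrMr.
have nE : n%:R = expR l by rewrite lnK.
have ceilP a : 0 < a -> a * l <= (Num.truncn (a * l)).+1%:R <= a * l + 1.
  move=> a0; rewrite (ltW (truncnS_gt _)) -natr1 lerD2r.
  by have /andP[] := truncn_itv (ltW (mulr_gt0 a0 l_gt0)).
have /andP[t1l t1u] := ceilP _ a1_gt0; set t1 := (Num.truncn _).+1 in t1l t1u.
have /andP[t2l t2u] := ceilP _ a2_gt0; set t2 := (Num.truncn _).+1 in t2l t2u.
have /andP[t3l t3u] := ceilP _ a3_gt0; set t3 := (Num.truncn _).+1 in t3l t3u.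
have tot : (t1 + t2 + t3 <= Num.truncn (l / ln 2 + l + eps * l))%N.
  rewrite truncn_ge_nat; last first.
    by rewrite !addr_ge0 ?mulr_ge0 ?invr_ge0 ?(ltW l_gt0) ?(ltW ln2) ?(ltW eps0).
  rewrite !natrD.
  have le12 : 12 <= l * eps by rewrite -ler_pdivrMr.
  have aE : a1 * l + a2 * l + a3 * l = l / ln 2 + l + 3 / 4 * (l * eps).
    by rewrite /a1 /a2 /a3; field; rewrite gt_eqF.
  clear -le12 aE t1u t2u t3u; lra.
apply: le_trans (probT_le_homo R ereg d_gt0 v tot).
have devb S := deviation_le S (ltW C0) esimp ereg eeig lamC Cd.
apply: le_trans (probT_le_upper esimp.1 ereg d_gt0 v t1 t2 t3 b0 eta_gt0 theta_gt0 devb).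
have [] := rates _ b0 bbeta; set c1 := _ / 2; set c2 := _ + _; set c3 := _ + _.
move=> c1w c2w c3w; rewrite lerD2l lerN2.
have c2_ge0 : 0 <= c2 by rewrite addr_ge0 ?expR_ge0 // divr_ge0 // sqr_ge0.
have c3_ge0 : 0 <= c3 by rewrite addr_ge0 ?expR_ge0 // divr_ge0 // sqr_ge0.
have c1_ge0 : 0 <= c1.
  by rewrite divr_ge0 // !addr_ge0 // ?mulr_ge0 // ?invr_ge0 ltW.
(* Since [n = exp l], the bound is [exp (l - w1 * a1 * l)], which decays because [1 < w1 * a1]. *)
have E1 : n%:R * c1 ^+ t1 <= delta / 3.
  apply: le_trans (X1P _ l1); rewrite mul1r.
  have -> : - ((w1 * a1 - 1) * l) = l + - (w1 * (a1 * l)) by ring.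
  by rewrite expRD -nE ler_wpM2l ?(ltW n_gt0) // expr_le_expR ?(ltW w1_gt0).
have E2 : c2 ^+ t2 / theta <= delta / 3.
  apply: le_trans (X2P _ l2); rewrite mulrC ler_wpM2l //.
  by rewrite -[_ * a2 * l]mulrA expr_le_expR ?(ltW w2_gt0).
have E3 : n%:R * c3 ^+ t3 <= delta / 3.
  apply: le_trans (X3P _ l3); rewrite mul1r.
  have -> : - ((w3 * a3 - 1) * l) = l + - (w3 * (a3 * l)) by ring.
  by rewrite expRD -nE ler_wpM2l ?(ltW n_gt0) // expr_le_expR ?(ltW w3_gt0).
have -> : delta = delta / 3 + delta / 3 + delta / 3 by field.
by rewrite !lerD.
Qed.

(** Splits the time into [a1 * l] doubling rounds and [a2 * l] final rounds, each slightly too few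
    for its phase. *)
Lemma probT_le_lower_tail (eps delta : R) :
  0 < eps -> eps <= 2^-1 -> 0 < delta -> exists X : R,
  forall n (e : rel 'I_n) (d : nat) (v : 'I_n),
    simple_graph e -> regular e d -> X <= ln n%:R -> X <= d%:R ->
    probT_le R e v (Num.truncn (ln n%:R / ln 2 + ln n%:R - eps * ln n%:R)) <= delta.
Proof.
move=> eps0 eps1 delta0.
have ln2 : 0 < ln 2 :> R by rewrite ln_gt0 // ltr1n.
have ln21 : ln 2 <= 1 :> R.
  by rewrite -ler_expR lnK ?posrE //; have := expR_ge1Dx (1 : R); lra.
have il2 : 1 <= (ln 2)^-1 :> R by rewrite invf_ge1.
pose a1 := (ln 2)^-1 - eps / 4; pose a2 := 1 - eps / 4.
have a1_gt0 : 0 < a1 by rewrite /a1; lra.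
have a2_gt0 : 0 < a2 by rewrite /a2; lra.
(* With [k <= d - 1] the exponent per round is at most [1 + eps / 8]; times [a2 = 1 - eps / 4] this
   is at most [1 - eps / 8]. *)
have [k kE] : exists k, k = 16 / eps by eexists.
have k_gt0 : 0 < k by rewrite kE divr_gt0.
have kV : k^-1 = eps / 16 by rewrite kE invf_div.
have d2 : 0 < delta / 2 by rewrite divr_gt0.
have e8 : 0 < eps / 8 by rewrite divr_gt0.
have l4 : 0 < ln 2 * (eps / 4) by rewrite mulr_gt0 // divr_gt0.
have [X1 X1P] := expR_decay_le (ler0n R 2) l4 d2.
(* [expR 2] absorbs the one extra round from rounding [t2] up. *)
have ke : 0 <= 2 * k * expR 2 by rewrite !mulr_ge0 ?expR_ge0 ?(ltW k_gt0).
have [X2 X2P] := expR_decay_le ke e8 d2.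
exists (Num.max X1 (Num.max X2 (Num.max k (2 + k)))).
move=> n e d v esimp ereg.
have n_gt0 : 0 < n%:R :> R by rewrite ltr0n; case: n v {e esimp ereg} => // [[]].
rewrite !ge_max; set l := ln n%:R.
move=> /andP[l1 /andP[lX2 /andP[lk _]]] /andP[_ /andP[_ /andP[_ dk]]].
have l_gt0 : 0 < l by exact: lt_le_trans lk.
have d1 : (1 < d)%N by rewrite -(ltr1n R); apply: lt_le_trans dk; lra.
have d_gt0 : (0 < d)%N by exact: ltnW.
have nE : n%:R = expR l by rewrite lnK.
have esym := esimp.1.
have leps : 16 <= l * eps by rewrite -ler_pdivrMr // -kE.
set m := Num.truncn _.
pose t1 := Num.truncn (a1 * l); pose t2 := (Num.truncn (a2 * l)).+1.
have /andP[t1u t1l] := truncn_itv (ltW (mulr_gt0 a1_gt0 l_gt0)); rewrite -/t1 in t1u t1l.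
have /andP[t2u t2l] := truncn_itv (ltW (mulr_gt0 a2_gt0 l_gt0)); rewrite -/t2 in t2u t2l.
have mt : (m <= t1 + t2)%N.
  rewrite /m truncn_le_nat -[(t1 + t2).+1%:R]natr1 natrD.
  have : (a1 + a2) * l = l / ln 2 + l - 1 / 2 * (l * eps).
    by rewrite /a1 /a2; field; rewrite gt_eqF.
  rewrite -natr1 in t1l; lra.
apply: le_trans (probT_le_homo R ereg d_gt0 v mt) _.
apply: le_trans (probT_le_lower esym ereg d_gt0 v t1 t2 k_gt0 d1) _.
have E1 : 2 * 2 ^+ t1 / n%:R <= delta / 2.
  apply: le_trans (X1P _ l1); rewrite -mulrA ler_pM2l //.
  have -> : 2 ^+ t1 = expR (t1%:R * ln 2) :> R by rewrite expRM_natl lnK ?posrE.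
  rewrite nE -expRN -expRD ler_expR.
  have : t1%:R * ln 2 <= a1 * l * ln 2 by rewrite ler_pM2r.
  have -> : a1 * l * ln 2 = l - ln 2 * (eps / 4) * l.
    by rewrite /a1; field; rewrite gt_eqF.
  by move=> H; rewrite lerBlDl.
have E2 : 2 * k * expR (1 + k^-1 + (d%:R - 1)^-1) ^+ t2 / n%:R <= delta / 2.
  apply: le_trans (X2P _ lX2); rewrite -!mulrA !ler_pM2l //.
  rewrite nE -expRN -expRM_natl -!expRD ler_expR.
  have dk1 : k <= d%:R - 1 by clear -dk; lra.
  have dV : (d%:R - 1)^-1 <= k^-1 by rewrite lef_pV2 ?posrE // (lt_le_trans k_gt0).
  have dp : 0 < (d%:R - 1)^-1 :> R by rewrite invr_gt0 (lt_le_trans k_gt0).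
  set W := 1 + k^-1 + _.
  have W0 : 0 <= W by rewrite !addr_ge0 // ?invr_ge0 ltW // -invr_gt0.
  have We : W <= 1 + eps / 8 by rewrite /W; clear -dV kV; lra.
  have t2u' : t2%:R <= a2 * l + 1 by rewrite -natr1 lerD2r.
  have al : 0 <= a2 * l + 1 by rewrite addr_ge0 // mulr_ge0 // ltW.
  have := le_trans (ler_wpM2r W0 t2u') (ler_wpM2l al We).
  have -> : (a2 * l + 1) * (1 + eps / 8) =
     l - eps / 8 * l - eps / 32 * (l * eps) + 1 + eps / 8 by rewrite /a2; field.
  have : 0 <= eps / 32 * (l * eps) by rewrite !mulr_ge0 // ltW.
  rewrite [eps * (8^-1 * l)]mulrA.
  by move: (t2%:R * W) (eps / 8 * l) (eps / 32 * (l * eps)); clear -eps1 => *; lra.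
by rewrite [leRHS]splitr lerD.
Qed.

End Asymptotics.

(** Once [ln n >= 1] the power of the logarithm is at least 1, so [d >= 2 * C * sqrt n]. *)
Lemma order_and_degree_large (R : realType) (C X : R) : 0 < C ->
  exists N : nat, forall n d : nat, (N <= n)%N ->
    2 * C * Num.sqrt (n%:R * (ln (n%:R : R)) `^ (9%:R^-1)) <= d%:R ->
    X <= ln n%:R /\ X <= d%:R.
Proof.
move=> C0; pose Y := X / (2 * C).
have C2 : 0 < 2 * C by rewrite mulr_gt0.
exists (maxn (Num.truncn (expR (Num.max X 1))).+1 (Num.truncn (Y ^+ 2)).+1) => n d.
rewrite geq_max => /andP[nX nY] dn.
have {}nX : expR (Num.max X 1) <= n%:R.
  by apply: le_trans (ltW (truncnS_gt _)) _; rewrite ler_nat.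
have {}nY : Y ^+ 2 <= n%:R.
  by apply: le_trans (ltW (truncnS_gt _)) _; rewrite ler_nat.
have n0 : 0 < n%:R :> R by apply: lt_le_trans nX; exact: expR_gt0.
have : Num.max X 1 <= ln n%:R by rewrite -ler_expR lnK.
rewrite ge_max => /andP[Xl l1]; split => //; apply: le_trans dn.
rewrite mulrC -ler_pdivrMr // -/Y (le_trans (ler_norm Y)) // -sqrtr_sqr.
rewrite ler_wsqrtr // (le_trans nY) // ler_peMr ?(ltW n0) //.
apply: (@le_trans _ _ (1 `^ 9%:R^-1)); first by rewrite powR1.
rewrite ge0_ler_powR ?invr_ge0 ?nnegrE //.
exact: le_trans l1.
Qed.

(** Both little-o terms are unfolded into [eps] and [delta], with [N] uniform over graphs and
    starting vertices. *)
Theorem theorem2 (R : realType) (C : R) (hC : 0 < C) :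
  forall eps delta : R, 0 < eps -> 0 < delta ->
  exists N : nat, forall (n : nat) (e : rel 'I_n) (d : nat) (lam : R) (v : 'I_n),
    (N <= n)%N ->
    simple_graph e -> regular e d -> connected_graph e ->
    second_eig_abs (adjmx R e) lam ->
    lam <= C * Num.sqrt d%:R ->
    2 * C * Num.sqrt (n%:R * (ln (n%:R : R)) `^ (9%:R^-1)) <= d%:R ->
    1 - delta <= @probT_within n R e v (ln (n%:R : R) / ln 2 + ln (n%:R : R))
                                    (eps * ln (n%:R : R)).
Proof.
move=> eps delta eps0 delta0.
have delta2 : 0 < delta / 2 by rewrite divr_gt0.
(* The lower tail requires [eps <= 1 / 2]; a narrower window gives a stronger bound. *)
pose eps' := Num.min eps 2^-1.
have eps'0 : 0 < eps' by rewrite lt_min eps0 invr_gt0 ltr0n.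
have eps'1 : eps' <= 2^-1 by rewrite ge_min lexx orbT.
have eps'e : eps' <= eps by rewrite ge_min lexx.
have [X1 X1P] := probT_le_upper_tail hC eps'0 delta2.
have [X2 X2P] := probT_le_lower_tail eps'0 eps'1 delta2.
have [N NP] := @order_and_degree_large R C (Num.max 1 (Num.max X1 X2)) hC.
exists N => n e d lam v Nn esimp ereg _ eeig lamC dn.
have [] := NP _ _ Nn dn; rewrite !ge_max => /andP[l1 /andP[lX1 lX2]] /andP[d1 /andP[dX1 dX2]].
have d0 : (0 < d)%N by rewrite -(ltr0n R) (lt_le_trans ltr01).
have up := X1P n e d lam v esimp ereg eeig lamC lX1 dX1.
have lo := X2P n e d v esimp ereg lX2 dX2.
move: l1 up lo; set l := ln n%:R; set L := _ + l => l1 up lo.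
have l0 : 0 < l by apply: lt_le_trans l1.
have L0 : 0 <= L.
  by rewrite addr_ge0 ?divr_ge0 ?(ltW l0) // ln_ge0 // ler1n.
have r0 : 0 <= eps * l by rewrite mulr_ge0 // ltW.
have rr : eps' * l <= eps * l by rewrite ler_pM2r.
apply: le_trans (probT_within_ge ereg d0 v (m := Num.truncn (L - eps * l)) _ _ _).
- apply: (@le_trans _ _ ((1 - delta / 2) - delta / 2)); first by lra.
  apply: lerB.
    by apply: le_trans up _; apply: probT_le_homo ereg d0 _ _ _ _; rewrite le_truncn // lerD2l.
  by apply: le_trans lo; apply: probT_le_homo ereg d0 _ _ _ _; rewrite le_truncn // lerD2l lerN2.
- exact: addr_ge0.
- by rewrite le_truncn // lerD2l (le_trans _ r0) // oppr_le0.
move=> t tL; rewrite truncn_ge_nat ?ltW //.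
by apply: le_lt_trans tL; rewrite ler0n.
Qed.
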